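(* Let $\Bbbk$ be an algebraically closed field. Let $G=(V,E)$ be a graph that is reducible into $G_1=(V_1,E_1)$ and $G_2=(V_2,E_2)$, and let $d=(d_v)_{v\in V}$ with integers $d_v\ge2$. If both $I_{\mathrm{gl}(G_1)}$ and $I_{\mathrm{gl}(G_2)}$ (taken with respect to $(d_v)_{v\in V_1}$ and $(d_v)_{v\in V_2}$) are radical, then $I_{\mathrm{gl}(G)}$ (with respect to $d$) is radical.
   Context: Graphs are finite, simple, undirected. $G=(V,E)$ is reducible into $G_1,G_2$ if $V_1,V_2\subsetneq V$ are proper subsets such that $V_1\cap V_2$ is a clique of $G$, $G_1$ and $G_2$ are the subgraphs of $G$ induced on $V_1$ and $V_2$, and $G$ is the union of $G_1$ and $G_2$ (both vertices and edges). For a graph $G=(V,E)$ and $d=(d_v)_{v\in V}$, let $\mathcal X=\prod_{v\in V}[d_v]$, $[m]=\{1,\dots,m\}$. The global Markov ideal $I_{\mathrm{gl}(G)}\subseteq\Bbbk[p_x:x\in\mathcal X]$ is generated by all binomials $p_{x_Ax_Bx_C}p_{x'_Ax'_Bx_C}-p_{x_Ax'_Bx_C}p_{x'_Ax_Bx_C}$, where $A,B,C$ range over all partitions $V=A\cup B\cup C$ into disjoint (possibly empty) sets such that every path in $G$ from a vertex of $A$ to a vertex of $B$ meets $C$, and $x_A,x'_A,x_B,x'_B,x_C$ range over all states of the respective subsets (elements of $\prod_{v\in A}[d_v]$, etc.). *)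

(* Defs.v *)
From mathcomp Require Import all_boot all_order all_algebra.
From mathcomp Require Import mpoly.

Set Implicit Arguments.
Unset Strict Implicit.
Unset Printing Implicit Defensive.

Import GRing.Theory.
Local Open Scope ring_scope.

(** Finite simple graphs *)

Record sgraph := SGraph {
  vertex :> finType;
  adj : rel vertex;
  adj_sym : ssrbool.symmetric adj;
  adj_irr : irreflexive adj
}.

Section Graphs.
Variable G : sgraph.

Definition clique (S : {set G}) : Prop :=
  forall u v : G, u \in S -> v \in S -> u != v -> adj u v.

Section Induced.
Variable S : {set G}.

Definition induced_adj : rel {v : G | v \in S} :=
  fun u v => adj (val u) (val v).

Lemma induced_adj_sym : ssrbool.symmetric induced_adj.
Proof. by move=> u v; exact: adj_sym. Qed.

Lemma induced_adj_irr : irreflexive induced_adj.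
Proof. by move=> u; exact: adj_irr. Qed.

Definition induced : sgraph := SGraph induced_adj_sym induced_adj_irr.

End Induced.

(* The last two clauses say that G is the union of [induced V1] and
   [induced V2], for the vertices and for the edges. *)
Definition reducible (V1 V2 : {set G}) : Prop :=
  [/\ V1 \proper [set: G], V2 \proper [set: G], clique (V1 :&: V2),
      V1 :|: V2 = [set: G]
    & forall u v : G, adj u v ->
        (u \in V1 /\ v \in V1) \/ (u \in V2 /\ v \in V2)].

(* The blocks may be empty, so this is not [finset.partition]. *)
Definition tripartition (A B C : {set G}) : Prop :=
  [/\ A :|: B :|: C = [set: G],
      [disjoint A & B], [disjoint A & C] & [disjoint B & C]].

(* The end vertices of a path count as lying on it. *)
Definition separates (C A B : {set G}) : Prop :=
  forall (x : G) (p : seq G),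
    path (@adj G) x p -> uniq (x :: p) -> x \in A -> last x p \in B ->
    exists2 c, c \in x :: p & c \in C.

End Graphs.

(** Ideals *)

Definition ideal_gen (R : comNzRingType) (S : R -> Prop) : R -> Prop :=
  fun f => exists (m : nat) (a g : 'I_m -> R),
    (forall i, S (g i)) /\ f = \sum_(i < m) a i * g i.

Definition radical (R : comNzRingType) (I : R -> Prop) : Prop :=
  forall (f : R) (n : nat), (0 < n)%N -> I (f ^+ n) -> I f.

(** Global Markov ideals *)

Section GlobalMarkov.
Variables (k : fieldType) (G : sgraph) (d : G -> nat).

(* [d_v] = {1, ..., d_v} is indexed from 0 here. *)
Definition state : finType := {dffun forall v : G, 'I_(d v)}.

(* k[p_x : x a state]; the variables are numbered by [enum_rank]. *)
Definition stpoly : comNzRingType := {mpoly k[#|state|]}.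

Definition pvar (x : state) : stpoly := 'X_(enum_rank x).

(* The state x_A x_B x_C.  States of a subset of G are given by states of G,
   of which only the restriction to that subset is used. *)
Definition glue (A B : {set G}) (xA xB xC : state) : state :=
  [ffun v => if v \in A then xA v else if v \in B then xB v else xC v].

Definition gmarkov_binomial (A B : {set G}) (xA xA' xB xB' xC : state)
    : stpoly :=
    pvar (glue A B xA xB xC) * pvar (glue A B xA' xB' xC)
  - pvar (glue A B xA xB' xC) * pvar (glue A B xA' xB xC).

Definition gmarkov_gens (f : stpoly) : Prop :=
  exists A B C : {set G},
    [/\ tripartition A B C, separates C A B
      & exists xA xA' xB xB' xC : state,
          f = gmarkov_binomial A B xA xA' xB xB' xC].

Definition gmarkov_ideal : stpoly -> Prop := ideal_gen gmarkov_gens.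

End GlobalMarkov.

(* Main.v *)
Require Import Defs.
From mathcomp Require Import all_boot all_order all_algebra.
From mathcomp Require Import mpoly ring zify.
From Stdlib Require Import Classical ClassicalEpsilon.

(* The Markov ideal I of G is generated by differences of monomials, so it induces a congruence
   on monomials and its zero set is closed under products.  Over an algebraically closed field,
   the zeros of a radical ideal of this kind separate the congruence classes (characters of
   subgroups of Z^n extend to Z^n).  A zero for G1 or G2 pulls back along the restriction of
   states to a zero for G, hence two monomials on which all zeros for G agree have marginals on
   V1 and V2 congruent for G1 and G2.  Swaps in G1 or G2 lift to G because V1 :&: V2 is a clique,
   and monomials with equal marginals are related by swaps of V2 :\: V1, so the zeros for G
   separate the classes of I too.  By independence of characters, any f vanishing on them lies
   in I; this applies whenever a power of f is in I. *)

Set Implicit Arguments.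
Unset Strict Implicit.
Unset Printing Implicit Defensive.

Import GRing.Theory.
Local Open Scope ring_scope.

(** * Ideals and independence of monomials *)

Definition is_ideal (R : comNzRingType) (I : R -> Prop) : Prop :=
  [/\ I 0, forall f g, I f -> I g -> I (f + g) & forall f g, I g -> I (f * g)].

Section IdealTheory.
Variables (R : comNzRingType) (I : R -> Prop).
Hypothesis idI : is_ideal I.

Lemma ideal0 : I 0. Proof. by case: idI. Qed.
Lemma idealD f g : I f -> I g -> I (f + g). Proof. by case: idI => _ + _; apply. Qed.
Lemma ideal_mull f g : I g -> I (f * g). Proof. by case: idI => _ _; apply. Qed.
Lemma ideal_mulr f g : I g -> I (g * f). Proof. by rewrite mulrC; apply: ideal_mull. Qed.
Lemma idealN f : I f -> I (- f).
Proof. by rewrite -mulN1r; apply: ideal_mull. Qed.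
Lemma ideal_sum (T : Type) (r : seq T) (P : pred T) (F : T -> R) :
  (forall i, P i -> I (F i)) -> I (\sum_(i <- r | P i) F i).
Proof. by move=> IF; apply: big_ind => //; [exact: ideal0 | exact: idealD]. Qed.

(* Each term of the binomial expansion contains x ^+ s or y ^+ t. *)
Lemma ideal_exprD_colon z x y s t :
  I (z * x ^+ s) -> I (z * y ^+ t) -> I (z * (x + y) ^+ (s + t)).
Proof.
move=> Ix Iy; rewrite exprDn mulr_sumr; apply: ideal_sum => i _.
rewrite -mulr_natr; set c := _%:R; have [le_ti|lt_it] := leqP t i.
  rewrite -(subnK le_ti) exprD; set u := x ^+ _; set v := y ^+ (i - t).
  have -> : z * (u * (v * y ^+ t) * c) = u * v * c * (z * y ^+ t) by ring.
  exact: ideal_mull.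
have le_s : (s <= s + t - i)%N by rewrite -addnBA ?leq_addr // ltnW.
rewrite -(subnK le_s) exprD; set u := x ^+ (_ - s); set v := y ^+ i.
have -> : z * (u * x ^+ s * v * c) = u * v * c * (z * x ^+ s) by ring.
exact: ideal_mull.
Qed.

End IdealTheory.

Lemma ideal_gen_is_ideal (R : comNzRingType) (S : R -> Prop) :
  is_ideal (ideal_gen S).
Proof.
split=> [|f g [m1 [a1 [g1 [S1 ->]]]] [m2 [a2 [g2 [S2 ->]]]]|f _ [m [a [g [Sg ->]]]]].
- by exists 0%N, (fun=> 0), (fun=> 0); split=> [[]|]//; rewrite big_ord0.
- pose comb (u1 : 'I_m1 -> R) (u2 : 'I_m2 -> R) i :=
    match split i with inl j => u1 j | inr j => u2 j end.
  exists (m1 + m2)%N, (comb a1 a2), (comb g1 g2); split=> [i|].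
    by rewrite /comb; case: (split i).
  rewrite big_split_ord /comb; congr (_ + _); apply: eq_bigr => i _.
    by rewrite (unsplitK (inl i)).
  by rewrite (unsplitK (inr i)).
- exists m, (fun i => f * a i), g; split=> //.
  by rewrite mulr_sumr; apply: eq_bigr => i _; rewrite mulrA.
Qed.

Lemma ideal_gen_sub (R : comNzRingType) (S : R -> Prop) f :
  S f -> ideal_gen S f.
Proof.
move=> Sf; exists 1%N, (fun=> 1), (fun=> f); split=> //.
by rewrite big_ord1 mul1r.
Qed.

Section Mval.
Variables (k : fieldType) (n : nat).
Implicit Types (a b : 'I_n -> k) (m : 'X_{1..n}).

Definition mval a m : k := \prod_(i < n) a i ^+ m i.

Lemma mevalXE a m : ('X_[m] : {mpoly k[n]}).@[a] = mval a m.
Proof. exact: mevalX. Qed.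

Lemma mval1 m : mval (fun=> 1) m = 1.
Proof. by rewrite /mval big1 // => i _; rewrite expr1n. Qed.

Lemma mvalM a b m : mval (fun i => a i * b i) m = mval a m * mval b m.
Proof. by rewrite -big_split; apply: eq_bigr => i _; rewrite exprMn. Qed.

Lemma mvalD a m m' : mval a (m + m')%MM = mval a m * mval a m'.
Proof. by rewrite -big_split; apply: eq_bigr => i _; rewrite mnmDE exprD. Qed.

Lemma mvalU a i : mval a U_(i)%MM = a i.
Proof. by rewrite -mevalXE mevalXU. Qed.

End Mval.

Section Dedekind.
Variables (k : fieldType) (n : nat) (Z : ('I_n -> k) -> Prop).
Hypothesis Z1 : Z (fun=> 1).
Hypothesis ZM : forall a b, Z a -> Z b -> Z (fun i => a i * b i).

(** Dedekind's independence of characters on the monoid [Z]. For a point [b] separating [m0] from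
    the first monomial [p.2], the relation at [a * b] minus [mval b p.2] times the relation at [a]
    loses the term [p] and scales [c0] by a nonzero factor. *)
Lemma dedekind_monomials (s : seq (k * 'X_{1..n})) c0 m0 :
    (forall p, p \in s -> exists2 a, Z a & mval a m0 != mval a p.2) ->
    (forall a, Z a ->
       c0 * mval a m0 + \sum_(p <- s) p.1 * mval a p.2 = 0) ->
  c0 = 0.
Proof.
elim: {s}(size s) {-2}s (erefl (size s)) c0 => [|N IHN] [|p s] //= => [_|[size_s]] c0 sep_s rel.
  by have := rel _ Z1; rewrite big_nil mval1 addr0 mulr1.
have [b Zb neq_b] := sep_s p (mem_head _ _).
pose f (q : k * 'X_{1..n}) := (q.1 * (mval b q.2 - mval b p.2), q.2).
have: c0 * (mval b m0 - mval b p.2) = 0.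
  apply: (IHN (map f s)) => [|q|a Za]; first by rewrite size_map.
    by case/mapP=> q' s_q' ->; apply: (sep_s q'); rewrite inE s_q' orbT.
  have := rel _ (ZM Za Zb); have := rel _ Za.
  rewrite big_map !big_cons /= !mvalM.
  set A := \sum_(q <- s) _; set B := \sum_(q <- s) _; set C := \sum_(q <- s) _.
  have ->: C = B - mval b p.2 * A.
    rewrite mulr_sumr -sumrB; apply: eq_bigr => q _ /=.
    by rewrite mvalM; ring.
  move=> eqA eqB; rewrite -[RHS](subr0 0) -[X in _ = X - _]eqB.
  by rewrite -(mulr0 (mval b p.2)) -eqA; ring.
by move/eqP; rewrite mulf_eq0 subr_eq0 (negPf neq_b) orbF => /eqP.
Qed.

Variable I : {mpoly k[n]} -> Prop.
Hypothesis idI : is_ideal I.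
Hypothesis sepZ : forall m m',
  (forall a, Z a -> mval a m = mval a m') -> I ('X_[m] - 'X_[m']).

Lemma ideal_of_vanishing f : (forall a, Z a -> f.@[a] = 0) -> I f.
Proof.
(* Lists may repeat monomials. If the head monomial agrees on [Z] with a later one, the two terms
   merge modulo [I]; otherwise independence forces the head coefficient to be zero. Either way the
   list gets shorter. *)
have vanish_seq (s : seq (k * 'X_{1..n})) :
    (forall a, Z a -> \sum_(p <- s) p.1 * mval a p.2 = 0) ->
  I (\sum_(p <- s) p.1 *: 'X_[p.2]).
  elim: {s}(size s) {-2}s (erefl (size s)) => [|N IHN] [|[c0 m0] s] //= => [_|[size_s]] rel.
    by rewrite big_nil; apply: ideal0.
  have [[[c m] s_m eq_m]|sep_m0] := classic (exists2 p, p \in s &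
    forall a, Z a -> mval a m0 = mval a p.2).
    have perm_s := perm_to_rem s_m.
    set s' := rem _ s in perm_s.
    have size_s' : N = (size s').+1 by rewrite -size_s (perm_size perm_s).
    have ->: \sum_(p <- (c0, m0) :: s) p.1 *: ('X_[p.2] : {mpoly k[n]})
       = c0 *: ('X_[m0] - 'X_[m]) + \sum_(p <- (c0 + c, m) :: s') p.1 *: 'X_[p.2].
      rewrite !big_cons (perm_big _ perm_s) big_cons /=.
      by rewrite scalerBr scalerDl; ring.
    apply: (idealD idI).
      by rewrite -mul_mpolyC; apply: (ideal_mull idI); apply: sepZ eq_m.
    apply: IHN => // a Za; apply: etrans (rel a Za); rewrite !big_cons (perm_big _ perm_s).
    by rewrite big_cons /= (eq_m a Za) /=; ring.
  have c00 : c0 = 0.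
    apply: (@dedekind_monomials s c0 m0) => [p s_p|a Za]; last first.
      by apply: etrans (rel a Za); rewrite big_cons.
    apply: NNPP => nsep; apply: sep_m0; exists p => // a Za.
    by apply/eqP/negPn/negP => neq; apply: nsep; exists a.
  rewrite big_cons c00 scale0r add0r; apply: IHN => // a Za.
  by apply: etrans (rel a Za); rewrite big_cons c00 mul0r add0r.
move=> f0; have := vanish_seq [seq (f@_m, m) | m <- msupp f].
rewrite big_map -mpolyE; apply=> a Za; apply: etrans (f0 a Za); rewrite big_map.
rewrite [in RHS](mpolyE f) raddf_sum; apply: eq_bigr => m _.
by rewrite /= mevalZ mevalXE.
Qed.

End Dedekind.

(** * Characters of abelian groups *)

Definition is_subgroup (V : zmodType) (H : V -> Prop) : Prop :=
  H 0 /\ forall x y, H x -> H y -> H (x - y).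

Definition is_character (V : zmodType) (k : fieldType) (H : V -> Prop)
    (chi : V -> k) : Prop :=
  [/\ is_subgroup H, forall x, H x -> chi x != 0
    & forall x y, H x -> H y -> chi (x + y) = chi x * chi y].

Section Subgroup.
Variables (V : zmodType) (H : V -> Prop).
Hypothesis subH : is_subgroup H.

Lemma subgroup0 : H 0. Proof. by case: subH. Qed.
Lemma subgroupB x y : H x -> H y -> H (x - y). Proof. by case: subH => _; apply. Qed.
Lemma subgroupN x : H x -> H (- x).
Proof. by rewrite -sub0r; apply/subgroupB/subgroup0. Qed.
Lemma subgroupD x y : H x -> H y -> H (x + y).
Proof. by move=> Hx Hy; rewrite -[y]opprK; apply/subgroupB/subgroupN. Qed.
Lemma subgroupMz x (i : int) : H x -> H (x *~ i).
Proof.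
move=> Hx; have Hn n : H (x *+ n).
  by elim: n => [|n IHn]; [exact: subgroup0 | rewrite mulrS; apply: subgroupD].
by case: i => n; [exact: Hn | rewrite NegzE mulrNz; apply/subgroupN/Hn].
Qed.

(* The integers i with x *~ i in H form an ideal of Z. *)
Lemma subgroup_multiples x :
  (forall i : int, H (x *~ i) -> i = 0) \/
  (exists r, [/\ (0 < r)%N, H (x *+ r) & forall i : int, H (x *~ i) -> (r %| i)%Z]).
Proof.
pose P n : bool := if excluded_middle_informative (H (x *+ n.+1)) then true else false.
have PP n : reflect (H (x *+ n.+1)) (P n).
  by rewrite /P; case: excluded_middle_informative => h; constructor.
have [exP|noP] := classic (exists n, P n).
  right; case: (ex_minnP exP) => r /PP Hr rmin; exists r.+1; split=> // i Hi.
  apply/dvdz_mod0P; set s := (i %% r.+1)%Z.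
  have Hs : H (x *~ s).
    rewrite /s /modz mulrzBr; apply: subgroupB => //.
    by rewrite mulrC mulrzA; apply: subgroupMz.
  have s_ge0 : 0 <= s by apply: modz_ge0.
  have s_lt : s < r.+1 by apply: ltz_pmod.
  case: s Hs s_ge0 s_lt => // -[|s] // Hs _ s_lt.
  by have := rmin s (introT (PP s) Hs); lia.
left; have no n : ~ H (x *+ n.+1) by move/PP=> Pn; apply: noP; exists n.
case=> [[|n]|n] Hx //; first by case: (no n).
case: (no n); rewrite NegzE mulrNz in Hx.
by rewrite -[_ *+ _]opprK; apply: subgroupN.
Qed.

End Subgroup.

Section Character.
Variables (V : zmodType) (k : closedFieldType).
Implicit Types (H : V -> Prop) (chi : V -> k).

Lemma character0 H chi : is_character H chi -> chi 0 = 1.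
Proof.
case=> -[H0 _] chi_n0 chiD; apply: (mulfI (chi_n0 0 H0)).
by rewrite -chiD // addr0 mulr1.
Qed.

Lemma characterMn H chi x n : is_character H chi -> H x -> chi (x *+ n) = chi x ^+ n.
Proof.
move=> chiP Hx; have [subH _ chiD] := chiP.
elim: n => [|n IHn]; first by rewrite mulr0n expr0 (character0 chiP).
by rewrite mulrS exprS chiD ?IHn //; apply: (subgroupMz subH n).
Qed.

Lemma characterMz H chi x (i : int) :
  is_character H chi -> H x -> chi (x *~ i) = chi x ^ i.
Proof.
move=> chiP Hx; have [subH chi_n0 chiD] := chiP.
case: i => n; first exact: (characterMn n chiP).
have Hxn : H (x *+ n.+1) by apply: (subgroupMz subH n.+1).
rewrite NegzE mulrNz -exprnN.
apply: (mulfI (chi_n0 _ Hxn)); rewrite -chiD //; last exact: subgroupN.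
by rewrite subrr (character0 chiP) (characterMn _ chiP) // divff ?expf_neq0 ?chi_n0.
Qed.

(** The extension to the subgroup generated by [H] and [v] sends [h + v *~ i] to [chi h * zeta ^ i];
    the last hypothesis makes this independent of the representation. *)
Lemma extend_character_value H chi v (zeta : k) :
    is_character H chi -> zeta != 0 ->
    (forall i : int, H (v *~ i) -> chi (v *~ i) = zeta ^ i) ->
  exists H' chi', [/\ is_character H' chi', H' v, chi' v = zeta
    & forall x, H x -> H' x /\ chi' x = chi x].
Proof.
move=> chiP zeta_n0 zetaP; have [subH chi_n0 chiD] := chiP.
pose H' x := exists p : V * int, H p.1 /\ x = p.1 + v *~ p.2.
(* One representation of each element is chosen arbitrarily; [chi'E] shows that the choice does not
   matter. *)
pose pick x := epsilon (inhabits ((0, 0) : V * int)) (fun p => H p.1 /\ x = p.1 + v *~ p.2).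
pose chi' x := chi (pick x).1 * zeta ^ (pick x).2.
have chi'E h i : H h -> chi' (h + v *~ i) = chi h * zeta ^ i.
  move=> Hh; rewrite /chi'; set x := h + _.
  have [|Hp xE] := epsilon_spec (inhabits ((0, 0) : V * int))
    (fun p => H p.1 /\ x = p.1 + v *~ p.2).
    by exists (h, i).
  rewrite -/(pick x) in Hp xE *; case: (pick x) Hp xE => /= h' j Hh' xE.
  have eq_h : h' - h = v *~ (i - j).
    by apply/eqP; rewrite mulrzBr subr_eq addrAC eq_sym subr_eq -xE addrC eqxx.
  have -> : h' = h + v *~ (i - j) by rewrite -eq_h addrC subrK.
  rewrite chiD // -?eq_h; try exact: subgroupB.
  rewrite eq_h zetaP; last by rewrite -eq_h; apply: subgroupB.
  by rewrite -mulrA -expfzDr // subrK.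
exists H', chi'; split.
- split=> [|x [[h i] [/= Hh ->]]|x y [[h i] [/= Hh ->]] [[h' j] [/= Hh' ->]]].
  + split=> [|x y [[h i] [/= Hh ->]] [[h' j] [/= Hh' ->]]].
      by exists (0, 0) => /=; rewrite mulr0z addr0; split=> //; case: subH.
    exists (h - h', i - j) => /=; split; first exact: subgroupB.
    by rewrite mulrzBr opprD addrACA.
  + by rewrite chi'E // mulf_neq0 ?chi_n0 ?expfz_neq0.
  + rewrite addrACA -mulrzDr !chi'E ?chiD ?expfzDr //; last exact: subgroupD.
    by ring.
- by exists (0, 1) => /=; rewrite add0r; split=> //; case: subH.
- by rewrite -[v in chi' v]add0r -[v in 0 + v]mulr1z chi'E ?(character0 chiP) ?mul1r //; case: subH.
- move=> x Hx; split; first by exists (x, 0); rewrite mulr0z addr0.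
  by rewrite -[x in chi' x]addr0 -(mulr0z v) chi'E // expr0z mulr1.
Qed.

(** If no nonzero multiple of [v] lies in [H], the value 1 at [v] works. Otherwise the multiples in
    [H] come from those of some [r], and any [r]-th root of [chi (v *+ r)] works. *)
Lemma extend_character H chi v :
    is_character H chi ->
  exists H' chi', [/\ is_character H' chi', H' v
    & forall x, H x -> H' x /\ chi' x = chi x].
Proof.
move=> chiP; have [subH chi_n0 chiD] := chiP.
suff [zeta zeta_n0 zetaP] : exists2 zeta : k, zeta != 0 &
    forall i : int, H (v *~ i) -> chi (v *~ i) = zeta ^ i.
  have [H' [chi' [? ? _ ?]]] := extend_character_value chiP zeta_n0 zetaP.
  by exists H', chi'.
have [trivH|[r [r_gt0 Hr divH]]] := subgroup_multiples subH v.
  exists 1; first exact: oner_neq0.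
  by move=> i /trivH->; rewrite mulr0z (character0 chiP).
have [zeta /eqP] := solve_monicpoly (fun i : nat => if i == 0%N then chi (v *+ r) else 0) r_gt0.
rewrite -(prednK r_gt0) big_ord_recl big1 ?addr0 /= ?expr0 ?mulr1; last first.
  by move=> i _; rewrite mul0r.
rewrite (prednK r_gt0) => /eqP zetar.
have zeta_n0 : zeta != 0.
  by apply: contraTneq (chi_n0 _ Hr) => zeta0; rewrite -zetar zeta0 expr0n gtn_eqF // eqxx.
exists zeta => // i /divH /dvdzP[q ->]; rewrite mulrC mulrzA (characterMz _ chiP) //.
by rewrite -pmulrn -zetar exprnP exprz_exp.
Qed.

Lemma extend_character_seq H chi (s : seq V) :
    is_character H chi ->
  exists H' chi', [/\ is_character H' chi', forall v, v \in s -> H' v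
    & forall x, H x -> H' x /\ chi' x = chi x].
Proof.
elim: s H chi => [|v s IHs] H chi chiP; first by exists H, chi.
have [H1 [chi1 [chi1P H1v ext1]]] := extend_character v chiP.
have [H2 [chi2 [chi2P H2s ext2]]] := IHs _ _ chi1P.
exists H2, chi2; split=> // [u|x Hx]; last first.
  by have [H1x <-] := ext1 x Hx; apply: ext2.
by rewrite inE => /predU1P[->|/H2s //]; case: (ext2 v H1v).
Qed.

End Character.

(* If 1 is the only r-th root of unity, then 'X^r - 1 = ('X - 1)^r; homogenizing gives the
   second alternative. *)
Lemma unity_root_or_exprB (k : closedFieldType) (r : nat) : (0 < r)%N ->
  (exists2 zeta : k, zeta ^+ r = 1 & zeta != 1) \/
  (forall (A : comAlgType k) (x y : A), (x - y) ^+ r = x ^+ r - y ^+ r).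
Proof.
move=> r_gt0.
have [[z zr z1]|no] := classic (exists2 zeta : k, zeta ^+ r = 1 & zeta != 1).
  by left; exists z.
right=> A x y.
have [rs def_rs] := closed_field_poly_normal ('X^r - 1 : {poly k}).
have lead1 : lead_coef ('X^r - 1 : {poly k}) = 1 by apply/monicP; apply: monicXnsubC.
rewrite lead1 scale1r in def_rs.
have rs1 : rs = nseq r 1.
  have size_rs : size rs = r.
    by apply/eqP; rewrite -eqSS -(size_prod_XsubC rs id) -def_rs size_XnsubC.
  rewrite -size_rs; apply/all_pred1P/allP => z rs_z /=; apply: contraT => z1; case: no.
  have : root ('X^r - 1 : {poly k}) z by rewrite def_rs root_prod_XsubC.
  by rewrite rootE !hornerE subr_eq0 => /eqP; exists z.
rewrite rs1 big_nseq iter_mulr_1 in def_rs.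
pose c i : k := (-1) ^+ i *+ 'C(r, i).
have exprB_c (B : comAlgType k) (u v : B) :
    (u - v) ^+ r = \sum_(i < r.+1) c i *: (u ^+ (r - i) * v ^+ i).
  rewrite exprBn; apply: eq_bigr => i _; rewrite /c -scalerMnl -mulrA; congr (_ *+ _).
  by rewrite -signr_odd mulr_sign -[in RHS]signr_odd scaler_sign.
(* Comparing coefficients of ['X^(r - j)] in ['X^r - 1 = ('X - 1)^r] shows that in [k] all signed
   binomial coefficients vanish except the two outer ones. *)
have cE (j : 'I_r.+1) : c j = (j == 0%N :> nat)%:R - (j == r :> nat)%:R.
  have := congr1 (fun p : {poly k} => p`_(r - j)) def_rs.
  rewrite polyC1 exprB_c coefB coefXn coef1 coef_sum (bigD1 j) //= big1 ?addr0.
    rewrite expr1n mulr1 coefZ coefXn eqxx mulr1 => <-; congr (_%:R - _%:R); have := ltn_ord j; lia.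
  move=> i neq_ij; rewrite expr1n mulr1 coefZ coefXn.
  suff -> : (r - j == r - i)%N = false by rewrite mulr0.
  apply: contraNF neq_ij => /eqP eq_ij; apply/eqP/val_inj => /=.
  by have := ltn_ord i; have := ltn_ord j; lia.
rewrite exprB_c; under eq_bigr => i _ do rewrite cE.
case: r r_gt0 {def_rs lead1 c exprB_c cE no rs1} => // r _.
rewrite big_ord_recl big_ord_recr /= big1 ?add0r => [|i _]; last first.
  by rewrite /bump /= add1n eqSS ltn_eqF ?subr0 ?scale0r // ltn_ord.
rewrite /bump /= add1n eqxx subn0 subnn !mulr0n subr0 !expr0 mulr1 mul1r.
by rewrite -[nat_of_bool true]/1%N mulr1n scale1r scaleN1r.
Qed.

(** * Points separating congruent monomials *)

Section Monomials.
Variable n : nat.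
Implicit Types m : 'X_{1..n}.

Lemma mulmnDr m N N' : (m *+ (N + N'))%MM = (m *+ N + m *+ N')%MM.
Proof. by apply/mnmP=> i; rewrite mnmDE !mulmnE mulnDr. Qed.

Lemma mnm_ind (P : 'X_{1..n} -> Prop) :
  P 0%MM -> (forall i, P U_(i)%MM) -> (forall m m', P m -> P m' -> P (m + m')%MM) ->
  forall m, P m.
Proof.
move=> P0 PU PD m; rewrite [m]multinomUE_id; apply: big_ind => // i _.
by elim: (m i) => [|N IHN]; rewrite ?mulm0n ?mulmS //; apply: PD.
Qed.

(** Exponent vectors are embedded in a group, where differences exist and characters can be
    extended. *)
Definition mnm_int m : {ffun 'I_n -> int} := [ffun i => (m i)%:Z].

Lemma mnm_intD m m' : mnm_int (m + m')%MM = mnm_int m + mnm_int m'.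
Proof. by apply/ffunP=> i; rewrite !ffunE mnmDE PoszD. Qed.

Lemma mnm_intMn m N : mnm_int (m *+ N)%MM = mnm_int m *+ N.
Proof.
elim: N => [|N IHN]; last by rewrite mulmS mulrS mnm_intD IHN.
by rewrite mulm0n mulr0n; apply/ffunP=> i; rewrite !ffunE mnm0E.
Qed.

Lemma mnm_int_inj : injective mnm_int.
Proof. by move=> m m' /ffunP eqm; apply/mnmP=> i; have := eqm i; rewrite !ffunE => -[]. Qed.

End Monomials.

Section MonomialCongruence.
Variables (k : comNzRingType) (n : nat) (I : {mpoly k[n]} -> Prop).
Hypothesis idI : is_ideal I.
Implicit Types m a b c u v : 'X_{1..n}.

Definition mcong m m' := I ('X_[m] - 'X_[m']).

Lemma mcong_refl m : mcong m m.
Proof. by rewrite /mcong subrr; apply: (ideal0 idI). Qed.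

Lemma mcong_sym m m' : mcong m m' -> mcong m' m.
Proof. by move/(idealN idI); rewrite opprB. Qed.

Lemma mcong_trans m2 m1 m3 : mcong m1 m2 -> mcong m2 m3 -> mcong m1 m3.
Proof.
rewrite /mcong => I12 I23; have := idealD idI I12 I23.
by rewrite addrA subrK.
Qed.

Lemma mcongD m1 m1' m2 m2' :
  mcong m1 m1' -> mcong m2 m2' -> mcong (m1 + m2)%MM (m1' + m2')%MM.
Proof.
rewrite /mcong => I1 I2; rewrite !mpolyXD.
have -> : 'X_[m1] * 'X_[m2] - 'X_[m1'] * 'X_[m2'] =
  'X_[m2] * ('X_[m1] - 'X_[m1']) + 'X_[m1'] * ('X_[m2] - 'X_[m2'])
  :> {mpoly k[n]} by ring.
by apply: (idealD idI); apply: (ideal_mull idI).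
Qed.

Lemma mcongMn m m' N : mcong m m' -> mcong (m *+ N)%MM (m' *+ N)%MM.
Proof.
move=> mm'; elim: N => [|N IHN]; first by rewrite !mulm0n; apply: mcong_refl.
by rewrite !mulmS; apply: mcongD.
Qed.

(** Divisibility is taken up to congruence, so that the face is a union of congruence classes and
    extension by zero respects the congruence. *)
Definition dvdpow a c := exists N e, mcong (c + e)%MM (a *+ N)%MM.

Lemma dvdpow0 a : dvdpow a 0%MM.
Proof. by exists 0%N, 0%MM; rewrite addm0 mulm0n; apply: mcong_refl. Qed.

Lemma dvdpow_refl a : dvdpow a a.
Proof. by exists 1%N, 0%MM; rewrite addm0 mulm1n; apply: mcong_refl. Qed.

Lemma dvdpowD a c c' : dvdpow a (c + c')%MM <-> dvdpow a c /\ dvdpow a c'.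
Proof.
split=> [[N [e ce]]|[[N [e ce]] [N' [e' ce']]]].
  split; first by exists N, (c' + e)%MM; rewrite addmA.
  by exists N, (c + e)%MM; rewrite addmA (addmC c').
exists (N + N')%N, (e + e')%MM; rewrite mulmnDr.
rewrite Monoid.mulmACA; exact: mcongD.
Qed.

Lemma dvdpow_cong a c c' : mcong c c' -> dvdpow a c -> dvdpow a c'.
Proof.
move=> cc' [N [e ce]]; exists N, e; apply: mcong_trans ce.
by apply: mcongD; [apply: mcong_sym | apply: mcong_refl].
Qed.

End MonomialCongruence.

Section BinomialNullstellensatz.
Variables (k : closedFieldType) (n : nat) (I : {mpoly k[n]} -> Prop).
Hypotheses (idI : is_ideal I) (radI : radical I).
Implicit Types (m a b c u v : 'X_{1..n}) (alpha : 'I_n -> k).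

(** For an ideal generated by differences of monomials these are exactly its zeros, described in a
    form visibly closed under coordinatewise products. *)
Definition binomial_point alpha :=
  forall c c', mcong I c c' -> mval alpha c = mval alpha c'.

(* The monomials dividing a power of a form a face, on which a character of Z^n trivial on
   congruent pairs can be prescribed; it is extended by zero outside of the face. *)
Lemma face_point a (H : {ffun 'I_n -> int} -> Prop) (chi : {ffun 'I_n -> int} -> k) :
    is_character H chi -> (forall c, dvdpow I a c -> H (mnm_int c)) ->
    (forall c c', mcong I c c' -> dvdpow I a c ->
       chi (mnm_int c) = chi (mnm_int c')) ->
  exists2 alpha, binomial_point alpha & forall c,
    [/\ dvdpow I a c -> mval alpha c = chi (mnm_int c)
      & ~ dvdpow I a c -> mval alpha c = 0].
Proof.
move=> chiP Hdiv chiI; have [subH _ chiD] := chiP.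
pose alpha i := if excluded_middle_informative (dvdpow I a U_(i)%MM)
  then chi (mnm_int U_(i)%MM) else 0.
have alphaE c : [/\ dvdpow I a c -> mval alpha c = chi (mnm_int c)
      & ~ dvdpow I a c -> mval alpha c = 0].
  elim/mnm_ind: c => [|i|m m' [IH1 IH0] [IH1' IH0']].
  - split=> [_|[]]; last exact: (dvdpow0 idI).
    rewrite /mval big1 => [|i _]; last by rewrite mnm0E expr0.
    suff -> : mnm_int (0%MM : 'X_{1..n}) = 0 by rewrite (character0 chiP).
    by apply/ffunP=> i; rewrite !ffunE mnm0E.
  - by rewrite mvalU /alpha; case: excluded_middle_informative.
  - rewrite mvalD; split=> [/(dvdpowD idI)[am am']|nam].
      by rewrite IH1 // IH1' // mnm_intD chiD //; apply: Hdiv.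
    have [am|/IH0->] := classic (dvdpow I a m); last by rewrite mul0r.
    have [am'|/IH0'->] := classic (dvdpow I a m'); last by rewrite mulr0.
    by case: nam; apply/(dvdpowD idI).
exists alpha => // c c' cc'; have [c1 c0] := alphaE c; have [c'1 c'0] := alphaE c'.
have [ac|nac] := classic (dvdpow I a c).
  by rewrite c1 // c'1 ?(chiI _ c') //; apply: dvdpow_cong ac.
by rewrite c0 // c'0 // => ac'; apply: nac; apply: dvdpow_cong ac' => //; apply: mcong_sym.
Qed.

(** The differences of congruent exponent vectors in the face of [a]: the elements on which a
    character must be 1 to define a point supported on that face. *)
Definition face_relations a (x : {ffun 'I_n -> int}) :=
  exists u v, [/\ x = mnm_int u - mnm_int v, mcong I u v & dvdpow I a v].

Lemma face_relations_subgroup a : is_subgroup (face_relations a).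
Proof.
split=> [|x y [u [v [-> uv av]]] [u' [v' [-> uv' av']]]].
  exists 0%MM, 0%MM; rewrite subrr; split=> //; [exact: mcong_refl|exact: dvdpow0].
exists (u + v')%MM, (v + u')%MM; split.
- by rewrite !mnm_intD opprB opprD addrACA; congr (_ + _); rewrite addrC.
- by apply: mcongD => //; apply: mcong_sym.
- by apply/(dvdpowD idI); split=> //; apply: dvdpow_cong av' => //; apply: mcong_sym.
Qed.

(** With [D = 'X_[a] - 'X_[b]], the relation puts [D ^+ r * 'X_[v]] in [I]. As [v] divides powers of
    both [a] and [b] modulo [I], also [D ^+ r] times a power of ['X_[a]], and times a power of
    ['X_[b]], lies in [I]. Hence so does a power of [D]. *)
Lemma mcong_of_face_relation a b r :
    (0 < r)%N -> dvdpow I a b -> dvdpow I b a ->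
    ('X_[a] - 'X_[b] : {mpoly k[n]}) ^+ r = 'X_[a] ^+ r - 'X_[b] ^+ r ->
    face_relations a ((mnm_int a - mnm_int b) *+ r) ->
  mcong I a b.
Proof.
move=> r_gt0 ab ba exprB [u [v [eq_uv uv av]]].
have eq_mnm : (a *+ r + v = b *+ r + u)%MM.
  apply: mnm_int_inj; rewrite !mnm_intD !mnm_intMn.
  rewrite -[mnm_int a *+ r](subrK (mnm_int b *+ r)) -mulrnBl eq_uv.
  by rewrite addrAC subrK addrC.
pose D : {mpoly k[n]} := 'X_[a] - 'X_[b].
have IDv : I (D ^+ r * 'X_[v]).
  rewrite exprB !mpolyXn mulrBl -!mpolyXD eq_mnm.
  by apply: (mcongD idI) => //; apply: mcong_refl.
have IDc c : dvdpow I c v -> exists N, I (D ^+ r * 'X_[c] ^+ N).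
  case=> N [e ve]; exists N.
  rewrite mpolyXn -[X in _ * X](subrK 'X_[v + e]) mulrDr; apply: (idealD idI).
    by apply: (ideal_mull idI); apply: (mcong_sym idI).
  by rewrite mpolyXD mulrA; apply: (ideal_mulr idI).
have [Na INa] := IDc a av.
(* Transitivity: [v] divides a power of [a], and [a] divides a power of [b]. *)
have bv : dvdpow I b v.
  case: av => N [e ve]; have [N' [e' ae']] := ba.
  exists (N' * N)%N, (e + e' *+ N)%MM; rewrite addmA.
  apply: (mcong_trans idI (m2 := ((a + e') *+ N)%MM)).
    have -> : ((a + e') *+ N = a *+ N + e' *+ N)%MM.
      by apply/mnmP=> i; rewrite mnmDE !mulmnE mnmDE mulnDl.
    by apply: mcongD => //; apply: mcong_refl.
  have -> : (b *+ (N' * N) = b *+ N' *+ N)%MM.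
    by apply/mnmP=> i; rewrite !mulmnE mulnA.
  exact: mcongMn.
have [Nb INb] := IDc b bv.
have : I (D ^+ r * (- 'X_[b]) ^+ Nb).
  by rewrite -mulN1r exprMn mulrCA; apply: (ideal_mull idI).
move=> /(ideal_exprD_colon idI INa); rewrite -exprD.
by apply: radI; rewrite ltn_addr.
Qed.

(** Points with values 0 and 1 show that [a] and [b] span the same face. On it, a character trivial
    on the relations with a value other than 1 at [a - b] would give a point separating [a] from
    [b]; when no such value exists, [mcong_of_face_relation] applies. *)
Theorem binomial_nullstellensatz a b :
  (forall alpha, binomial_point alpha -> mval alpha a = mval alpha b) -> mcong I a b.
Proof.
move=> eq_ab.
have face_dvd a0 b0 : (forall alpha, binomial_point alpha -> mval alpha a0 = mval alpha b0) ->
  dvdpow I a0 b0.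
  (* The trivial character gives the indicator function of the face of [a0], with value 1 at [a0]
     and 0 at [b0]. *)
  move=> eq0; apply: NNPP => nab.
  have [|||alpha alphaP alphaE] := @face_point a0 (fun=> True) (fun=> 1).
  - by split=> // [|x y _ _]; [rewrite oner_eq0 | rewrite mulr1].
  - by [].
  - by [].
  have [a1 _] := alphaE a0; have [_ b1] := alphaE b0.
  have := eq0 _ alphaP; rewrite a1 ?b1 //; last exact: (dvdpow_refl idI).
  by move/eqP; rewrite oner_eq0.
have ab := face_dvd a b eq_ab.
have ba : dvdpow I b a by apply: face_dvd => alpha /eq_ab.
pose w := mnm_int a - mnm_int b.
have triv_char : is_character (face_relations a) (fun=> 1 : k).
  split=> [|x _|x y _ _]; [exact: face_relations_subgroup|exact: oner_neq0|by rewrite mulr1].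
suff [//|[zeta [zeta_n0 zeta_n1 zetaP]]] : mcong I a b \/
  exists zeta : k, [/\ zeta != 0, zeta != 1 & forall i : int, face_relations a (w *~ i) -> 1 = zeta ^ i].
  have [H1 [chi1 [chi1P H1w chi1w ext1]]] := extend_character_value triv_char zeta_n0 zetaP.
  (* Extending over the unit vectors brings every exponent vector into the domain of the
     character. *)
  pose basis := [seq mnm_int U_(i)%MM | i : 'I_n].
  have [H2 [chi2 [chi2P H2b ext2]]] := extend_character_seq basis chi1P.
  have [subH2 chi2_n0 chi2D] := chi2P.
  have H2m c : H2 (mnm_int c).
    elim/mnm_ind: c => [|i|m m' H2m H2m'].
    - suff -> : mnm_int (0%MM : 'X_{1..n}) = 0 by case: subH2.
      by apply/ffunP=> i; rewrite !ffunE mnm0E.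
    - by apply: H2b; apply/mapP; exists i; rewrite ?mem_enum.
    - by rewrite mnm_intD; apply: subgroupD.
  have chi2K c c' : mcong I c c' -> dvdpow I a c -> chi2 (mnm_int c) = chi2 (mnm_int c').
    move=> cc' ac; rewrite -(subrK (mnm_int c') (mnm_int c)) chi2D //; last exact: subgroupB.
    have Kx : face_relations a (mnm_int c - mnm_int c').
      by exists c, c'; split=> //; apply: dvdpow_cong ac.
    have [H1x chi1x] := ext1 _ Kx; have [_ ->] := ext2 _ H1x.
    by rewrite chi1x mul1r.
  have [alpha alphaP alphaE] := face_point chi2P (fun c _ => H2m c) chi2K.
  have [alpha_a _] := alphaE a; have [alpha_b _] := alphaE b.
  have := eq_ab _ alphaP; rewrite alpha_a ?alpha_b //; last exact: (dvdpow_refl idI).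
  rewrite -(subrK (mnm_int b) (mnm_int a)) chi2D -/w //; last exact: subgroupB.
  have [_ ->] := ext2 _ H1w; rewrite chi1w => eq_b.
  by case/eqP: zeta_n1; apply: (mulIf (chi2_n0 _ (H2m b))); rewrite mul1r.
have [trivK|[r [r_gt0 Kr divK]]] := subgroup_multiples (face_relations_subgroup a) w.
  (* Any value other than 0 and 1 is allowed here; a root of [zeta ^+ 2 = 1 + zeta] is one in every
     characteristic. *)
  right; have [zeta] := solve_monicpoly (fun=> 1 : k) (ltn0Sn 1).
  rewrite big_ord_recl big_ord1 /= !mul1r => zeta2.
  exists zeta; split=> [||i /trivK-> //].
    by apply/eqP=> z0; move/eqP: zeta2; rewrite z0 expr0n expr0 /bump /= addr0 eq_sym oner_eq0.
  apply/eqP=> z1; move/eqP: zeta2; rewrite z1 !expr1n -subr_eq0 opprD addrA subrr sub0r.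
  by rewrite oppr_eq0 oner_eq0.
(* Now [w] has order [r] modulo the relations, so the admissible values are the [r]-th roots of
   unity. *)
have [[zeta zetar zeta_n1]|exprB] := unity_root_or_exprB k r_gt0; [right|left].
  have zeta_n0 : zeta != 0.
    by apply: contra_eq_neq zetar => ->; rewrite expr0n gtn_eqF // eq_sym oner_eq0.
  exists zeta; split=> // i /divK /dvdzP[q ->].
  by rewrite mulrC -exprz_exp -exprnP zetar exp1rz.
by apply: (@mcong_of_face_relation _ _ r) => //; apply: exprB.
Qed.

End BinomialNullstellensatz.

(** * Marginals and swaps *)

Lemma mnm_consind n (P : 'X_{1..n} -> Prop) :
  P 0%MM -> (forall i m, P m -> P (U_(i) + m)%MM) -> forall m, P m.
Proof.
move=> P0 PU m; rewrite -[m]addm0; move: (0%MM) P0.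
elim/mnm_ind: m => [|i|m m' IHm IHm'] m0 Pm0; rewrite ?add0m; auto.
by rewrite -addmA; auto.
Qed.

Section Pushforward.
Variables (n n' : nat) (s : 'I_n -> 'I_n').
Implicit Types m : 'X_{1..n}.

(** The exponent vector of the image of ['X_[m]] under the ring map sending each variable ['X_i] to
    ['X_(s i)]. *)
Definition mnm_push m : 'X_{1..n'} := [multinom (\sum_(i | s i == j) m i)%N | j < n'].

Lemma mnm_pushD m m' : mnm_push (m + m')%MM = (mnm_push m + mnm_push m')%MM.
Proof.
by apply/mnmP=> j; rewrite mnmDE !mnmE -big_split; apply: eq_bigr => i _; rewrite mnmDE.
Qed.

Lemma mnm_pushU i : mnm_push U_(i)%MM = U_(s i)%MM.
Proof.
apply/mnmP=> j; rewrite mnmE mnm1E big_mkcond (bigD1 i) //= big1 ?addn0 ?mnm1E ?eqxx.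
  by case: eqP.
by move=> i' /negPf neq; rewrite mnm1E (eq_sym i) neq if_same.
Qed.

(** The sum over the fibre of [j] is positive, so some variable in the fibre divides [m]. This lifts
    factors of a marginal to factors of the monomial. *)
Lemma mnm_push_cover m j c : mnm_push m = (U_(j) + c)%MM ->
  exists i m', [/\ s i = j, m = (U_(i) + m')%MM & mnm_push m' = c].
Proof.
move=> eq_m; have [i /andP[/eqP si mi]] : exists i, (s i == j) && (0 < m i)%N.
  apply/existsP; apply: contra_eqT (congr1 (fun u : 'X_{1..n'} => u j) eq_m) => /existsPn noi.
  rewrite mnmE mnmDE mnm1E eqxx big1 // => i /eqP si; have := noi i.
  by rewrite si eqxx /= -eqn0Ngt => /eqP.
have mE : m = (U_(i) + (m - U_(i)))%MM.
  rewrite addmC submK //; apply/mnm_lepP=> l; rewrite mnm1E.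
  by case: eqP => // <-.
exists i, (m - U_(i))%MM; split=> //.
by apply: (@addmI _ U_(j)%MM); rewrite -eq_m {2}mE mnm_pushD mnm_pushU si.
Qed.

Lemma mnm_push_eq0 m : mnm_push m = 0%MM -> m = 0%MM.
Proof.
move=> m0; apply/mnmP=> i; rewrite mnm0E; apply/eqP; rewrite -leqn0.
have := congr1 (fun u : 'X_{1..n'} => u (s i)) m0; rewrite mnmE mnm0E => <-.
by rewrite (bigD1 i) //= leq_addr.
Qed.

Lemma mval_push (k : fieldType) (a : 'I_n' -> k) m :
  mval a (mnm_push m) = mval (a \o s) m.
Proof.
elim/mnm_consind: m => [|i m IHm]; last by rewrite mnm_pushD !mvalD mnm_pushU !mvalU IHm.
rewrite /mval !big1 // => i _; first by rewrite mnm0E expr0.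
by rewrite mnmE big1 ?expr0 // => i' _; rewrite mnm0E.
Qed.

End Pushforward.

Section InvariantClasses.
Variables (k : fieldType) (n : nat) (S : {mpoly k[n]} -> Prop) (P : pred 'X_{1..n}).
Hypothesis SP : forall f, S f -> exists p q,
  f = 'X_[p] - 'X_[q] /\ forall c, P (c + p)%MM = P (c + q)%MM.

(** The degree bound only makes the sum finite; [null] asks for vanishing at all large bounds. *)
Let classsum (K : nat) (f : {mpoly k[n]}) : k :=
  \sum_(m : 'X_{1..n < K} | P m) f@_m.

Let classsumD K f g : classsum K (f + g) = classsum K f + classsum K g.
Proof. by rewrite -big_split; apply: eq_bigr => m _; rewrite mcoeffD. Qed.

Let classsumZ K c f : classsum K (c *: f) = c * classsum K f.
Proof. by rewrite mulr_sumr; apply: eq_bigr => m _; rewrite mcoeffZ. Qed.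

Let classsumX K m : (mdeg m < K)%N -> classsum K 'X_[m] = (P m)%:R.
Proof.
move=> ltmK; rewrite /classsum big_mkcond (bigD1 (BMultinom ltmK)) //= mcoeffX eqxx big1.
  by rewrite addr0; case: (P m).
move=> m' neq; rewrite mcoeffX; suff -> : (m == m') = false by rewrite if_same.
by apply: contraNF neq => /eqP eq_m; apply/eqP/val_inj.
Qed.

Let null f := exists K0, forall K, (K0 <= K)%N -> classsum K f = 0.

Let null_sum (T : Type) (r : seq T) (F : T -> {mpoly k[n]}) :
  (forall i, null (F i)) -> null (\sum_(i <- r) F i).
Proof.
move=> nullF; apply: big_ind => // [|f g [K1 f0] [K2 g0]].
  by exists 0%N => K _; rewrite /classsum big1 // => m _; rewrite mcoeff0.
exists (maxn K1 K2) => K; rewrite geq_max => /andP[le1 le2].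
by rewrite classsumD f0 // g0 // addr0.
Qed.

(** The sum of the coefficients over the monomials in [P] is linear and kills all multiples of
    generators, while on ['X_[a] - 'X_[b]] it is the difference of the two truth values. *)
Lemma invariant_of_ideal_gen a b : ideal_gen S ('X_[a] - 'X_[b]) -> P a = P b.
Proof.
move=> [N [u [g [Sg eq_ab]]]].
have [K0 nullK] : null ('X_[a] - 'X_[b]).
  rewrite eq_ab; apply: null_sum => i; have [p [q [-> Ppq]]] := SP (Sg i).
  rewrite (mpolyE (u i)) mulr_suml; apply: null_sum => c.
  exists (maxn (mdeg (c + p)) (mdeg (c + q))).+1 => K; rewrite gtn_max => /andP[ltp ltq].
  rewrite -scalerAl mulrBr -!mpolyXD classsumZ classsumD -scaleN1r classsumZ !classsumX //.
  by rewrite Ppq mulN1r subrr mulr0.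
have := nullK (maxn K0 (maxn (mdeg a) (mdeg b)).+1) (leq_maxl _ _).
set K := maxn _ _.
have : (maxn (mdeg a) (mdeg b) < K)%N by apply: leq_maxr.
rewrite gtn_max => /andP[lta ltb].
rewrite classsumD -scaleN1r classsumZ !classsumX // mulN1r.
by case: (P a); case: (P b) => // /eqP; rewrite ?subr0 ?sub0r ?oppr_eq0 oner_eq0.
Qed.

End InvariantClasses.

Section Swaps.
Variables (k : closedFieldType) (G : sgraph) (d : G -> nat).
Implicit Types (A B C : {set G}) (x y : state d).

(** Since the blocks cover all vertices, a path from [A] to [B] avoiding [C] must contain an edge
    from [A] to [B]; conversely such an edge is itself a path avoiding [C]. *)
Lemma separatesP A B C : tripartition A B C ->
  separates C A B <-> (forall a b, a \in A -> b \in B -> ~~ adj a b).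
Proof.
case=> /setP covG dAB dAC dBC; split=> [sepC a b Aa Bb|noadj x p].
  apply/negP=> ab; have neq_ab : a != b.
    by apply: contraTneq Bb => <-; rewrite (disjointFr dAB).
  have path_ab : path (@adj G) a [:: b] by rewrite /= ab.
  have uniq_ab : uniq [:: a; b] by rewrite /= inE neq_ab.
  have [c] := sepC _ _ path_ab uniq_ab Aa Bb.
  by rewrite !inE => /orP[]/eqP->; [rewrite (disjointFr dAC Aa) | rewrite (disjointFr dBC Bb)].
elim: p x => [|y p IHp] x /=.
  by move=> _ _ Ax; rewrite (disjointFr dAB Ax).
case/andP=> xy py /andP[_ uniq_p] Ax Bl.
have [Cx|nCx] := boolP (x \in C); first by exists x; rewrite ?mem_head.
have [Cy|nCy] := boolP (y \in C); first by exists y; rewrite // !inE eqxx orbT.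
have := covG y; rewrite !inE (negPf nCy) orbF => /orP[Ay|By].
  by have [c pc Cc] := IHp y py uniq_p Ay Bl; exists c; rewrite // inE pc orbT.
by have := noadj _ _ Ax By; rewrite xy.
Qed.

Definition swap A x y : state d := [ffun v => if v \in A then y v else x v].

(** Equivalently, the vertices outside [A] where [x] and [y] agree separate [A] from those where
    they differ. *)
Definition swappable A x y := forall a b, a \in A -> b \notin A -> adj a b -> x b = y b.

Definition mvar x : 'X_{1..#|state d|} := U_(enum_rank x)%MM.

Notation Igl := (gmarkov_ideal (k := k) (d := d) : {mpoly k[#|state d|]} -> Prop).

Lemma gmarkov_is_ideal : is_ideal Igl.
Proof. exact: ideal_gen_is_ideal. Qed.

Lemma mcong_swap A x y : swappable A x y ->
  mcong Igl (mvar x + mvar y)%MM (mvar (swap A x y) + mvar (swap A y x))%MM.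
Proof.
move=> swA; rewrite /mcong !mpolyXD; apply: ideal_gen_sub.
pose C := [set v | (v \notin A) && (x v == y v)].
pose B := [set v | (v \notin A) && (x v != y v)].
have ABC : tripartition A B C.
  split; first by apply/setP=> v; rewrite !inE; case: (v \in A); case: (x v == y v).
  - by rewrite disjoints_subset; apply/subsetP=> v; rewrite !inE => ->.
  - by rewrite disjoints_subset; apply/subsetP=> v; rewrite !inE => ->.
  - rewrite disjoints_subset; apply/subsetP=> v; rewrite !inE => /andP[_ /negPf->].
    by rewrite andbF.
exists A, B, C; split=> //.
  apply/(separatesP ABC) => a b Aa; rewrite inE => /andP[nAb neq_b].
  by apply: contra neq_b => ab; apply/eqP/(swA a b).
exists x, y, x, y, x; rewrite /gmarkov_binomial.
rewrite [X in _ - X]mulrC; congr (pvar _ _ * pvar _ _ - pvar _ _ * pvar _ _);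
  apply/ffunP=> v; rewrite !ffunE !inE; by case: (v \in A) => //=; case: (x v =P y v).
Qed.

Lemma gmarkov_gens_swap (f : {mpoly k[#|state d|]}) : gmarkov_gens (k := k) (d := d) f ->
  exists A x y, swappable A x y /\
    f = 'X_[mvar x + mvar y] - 'X_[mvar (swap A x y) + mvar (swap A y x)].
Proof.
case=> A [B [C [ABC sepC [xA [xA' [xB [xB' [xC ->]]]]]]]].
have noadj := (separatesP ABC).1 sepC; case: ABC => _ dAB _ _.
exists A, (glue A B xA xB xC), (glue A B xA' xB' xC); split.
  move=> a b Aa nAb ab; rewrite !ffunE (negPf nAb).
  by case: ifP => // /(noadj a b Aa); rewrite ab.
rewrite !mpolyXD /gmarkov_binomial [X in _ - X]mulrC.
congr (_ - pvar _ _ * pvar _ _); apply/ffunP=> v; rewrite !ffunE; by case: (v \in A).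
Qed.

Definition swap_invariant (alpha : 'I_#|state d| -> k) := forall A x y, swappable A x y ->
  alpha (enum_rank x) * alpha (enum_rank y) =
  alpha (enum_rank (swap A x y)) * alpha (enum_rank (swap A y x)).

Lemma meval_gmarkov alpha f : swap_invariant alpha -> Igl f -> f.@[alpha] = 0.
Proof.
move=> alphaP [N [u [g [gensg ->]]]].
rewrite raddf_sum big1 // => i _ /=; rewrite mevalM.
have [A [x [y [swA ->]]]] := gmarkov_gens_swap (gensg i).
by rewrite mevalB !mevalXE !mvalD !mvalU (alphaP _ _ _ swA) subrr mulr0.
Qed.

Lemma binomial_pointP alpha : binomial_point Igl alpha <-> swap_invariant alpha.
Proof.
split=> [alphaP A x y /mcong_swap/alphaP|alphaP c c' /(meval_gmarkov alphaP)].
  by rewrite !mvalD !mvalU.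
by rewrite mevalB !mevalXE => /eqP; rewrite subr_eq0 => /eqP.
Qed.

End Swaps.

Section Marginals.
Variables (k : closedFieldType) (G : sgraph) (d : G -> nat).
Implicit Types (W : {set G}) (x y : state d) (m : 'X_{1..#|state d|}).

Definition restr W x : state (fun v : induced W => d (val v)) := [ffun v => x (val v)].

Definition restr_rank W (i : 'I_#|state d|) := enum_rank (restr W (enum_val i)).

Definition marginal W m := mnm_push (restr_rank W) m.

Lemma marginalD W m m' : marginal W (m + m')%MM = (marginal W m + marginal W m')%MM.
Proof. exact: mnm_pushD. Qed.

Lemma marginalX W x : marginal W (mvar x) = mvar (restr W x).
Proof. by rewrite /marginal mnm_pushU /restr_rank enum_rankK. Qed.

Lemma marginal_cover W m (y : state (fun v : induced W => d (val v))) c :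
    marginal W m = (mvar y + c)%MM ->
  exists x m', [/\ restr W x = y, m = (mvar x + m')%MM & marginal W m' = c].
Proof.
case/mnm_push_cover=> i [m' [ri -> eq_c]]; exists (enum_val i), m'.
by rewrite /mvar enum_valK; split=> //; apply: enum_rank_inj.
Qed.

Lemma swappable_restr W A x y : swappable A x y ->
  swappable [set v : induced W | val v \in A] (restr W x) (restr W y).
Proof. by move=> swA a b; rewrite !inE !ffunE; apply: swA. Qed.

Lemma restr_swap W A x y :
  restr W (swap A x y) = swap [set v : induced W | val v \in A] (restr W x) (restr W y).
Proof. by apply/ffunP=> v; rewrite !ffunE inE. Qed.

Notation Igl := (gmarkov_ideal (k := k) (d := d) : {mpoly k[#|state d|]} -> Prop).
Notation Imarg W := (gmarkov_ideal (k := k) (d := fun v : induced W => d (val v))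
  : {mpoly k[#|state (fun v : induced W => d (val v))|]} -> Prop).

(** Restriction of states carries a swap on [A] to a swap on the trace of [A] in [W]. *)
Lemma binomial_point_restr W alpha : binomial_point (Imarg W) alpha ->
  binomial_point Igl (alpha \o restr_rank W).
Proof.
move/binomial_pointP=> alphaP; apply/binomial_pointP=> A x y swA.
by rewrite /= /restr_rank !enum_rankK !restr_swap; apply/alphaP/swappable_restr.
Qed.

Section Lift.
Variables V1 V2 : {set G}.
Hypothesis Gred : reducible V1 V2.

(* Since V1 :&: V2 is a clique, at most one side of a separation of G1 meets it outside of the
   separator; V2 :\: V1 is attached to that side. *)
Lemma lift_swap (A1 : {set induced V1}) x y :
    swappable A1 (restr V1 x) (restr V1 y) ->
  exists A, [/\ swappable A x y, restr V1 (swap A x y) = swap A1 (restr V1 x) (restr V1 y),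
    restr V1 (swap A y x) = swap A1 (restr V1 y) (restr V1 x)
    & (mvar (restr V2 (swap A x y)) + mvar (restr V2 (swap A y x)) =
       mvar (restr V2 x) + mvar (restr V2 y))%MM].
Proof.
case: Gred => _ _ clq /setP covV edgeV swA1.
have swA1' a b (V1a : a \in V1) (V1b : b \in V1) : Sub a V1a \in A1 -> Sub b V1b \notin A1 ->
  adj a b -> x b = y b.
  by move=> Aa nAb ab; have := swA1 _ _ Aa nAb ab; rewrite !ffunE.
have in_im (v : induced V1) : (val v \in val @: A1) = (v \in A1).
  by rewrite mem_imset //; apply: val_inj.
have restr_ext (A : {set G}) u w : (forall v, v \in V1 -> (v \in A) = (v \in val @: A1)) ->
  restr V1 (swap A u w) = swap A1 (restr V1 u) (restr V1 w).
  move=> AV1; apply/ffunP=> v; rewrite !ffunE AV1 ?in_im //.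
  exact: (valP v).
have [[s As V2s]|noS] := classic (exists2 s : induced V1, s \in A1 & val s \in V2).
  exists (val @: A1 :|: ~: V1).
  have AV1 v : v \in V1 -> (v \in val @: A1 :|: ~: V1) = (v \in val @: A1).
    by move=> V1v; rewrite !inE V1v orbF.
  (* Such a [b] lies in the clique, hence is adjacent to [s]. So [x] and [y] agree on the part of
     [V2] outside the swapped set, and the two restrictions to [V2] are merely exchanged. *)
  have swS b : b \in V2 -> b \notin val @: A1 :|: ~: V1 -> x b = y b.
    rewrite !inE negb_or negbK => V2b /andP[nAb V1b].
    have nA1b : Sub b V1b \notin A1 by rewrite -in_im.
    have neq_sb : val s != b by apply: contraNneq nAb => <-; rewrite in_im.
    apply: (@swA1' (val s) b (valP s) V1b) => //.
      by rewrite (_ : Sub _ _ = s) //; apply: val_inj.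
    by apply: clq => //; rewrite inE ?V2s ?V2b ?andbT //; apply: (valP s).
  split; try exact: restr_ext.
    move=> a b Aa nAb ab; have [V2b|nV2b] := boolP (b \in V2); first exact: swS.
    case: (edgeV a b ab) => -[]; last by rewrite (negPf nV2b).
    move=> V1a V1b; rewrite AV1 // in Aa; rewrite AV1 // in nAb.
    by apply: (@swA1' a b V1a V1b); rewrite -?in_im.
  rewrite addmC; congr (mvar _ + mvar _)%MM; apply/ffunP=> -[v V2v]; rewrite !ffunE /=;
    by case: ifPn => // /(swS _ V2v) ->.
(* Here the swapped set misses [V2], so both restrictions to [V2] stay fixed. *)
exists (val @: A1).
have nV2 a : a \in val @: A1 -> a \notin V2.
  by case/imsetP=> s As ->; apply/negP=> V2s; apply: noS; exists s.
split; try exact: restr_ext.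
  move=> a b Aa nAb ab; case: (edgeV a b ab) => -[]; last by rewrite (negPf (nV2 a Aa)).
  move=> V1a V1b.
  by apply: (@swA1' a b V1a V1b); rewrite -?in_im.
congr (mvar _ + mvar _)%MM; apply/ffunP=> -[v V2v]; rewrite !ffunE /=;
  by case: ifPn => // /nV2; rewrite V2v.
Qed.

(** The property [Q], that a given monomial is the [V1]-marginal of some monomial congruent to [m]
    with the same [V2]-marginal, is preserved by swaps in the first graph, hence constant on
    congruence classes. *)
Lemma lift_mcong m a b : mcong (Imarg V1) a b -> marginal V1 m = a ->
  exists m', [/\ mcong Igl m m', marginal V1 m' = b & marginal V2 m' = marginal V2 m].
Proof.
move=> ab ma.
have idI := gmarkov_is_ideal k d.
pose Q c := exists m', [/\ mcong Igl m m', marginal V1 m' = c & marginal V2 m' = marginal V2 m].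
pose P c : bool := if excluded_middle_informative (Q c) then true else false.
have PQ c : reflect (Q c) (P c).
  by rewrite /P; case: excluded_middle_informative => h; constructor.
have swQ A1 (u v : state (fun v : induced V1 => d (val v))) c : swappable A1 u v ->
  Q (c + (mvar u + mvar v))%MM -> Q (c + (mvar (swap A1 u v) + mvar (swap A1 v u)))%MM.
  move=> swA1 [m' [mm' + eq2]]; rewrite addmC -addmA.
  case/marginal_cover=> x [m1 [ux m'E]] /marginal_cover[y [m2 [vy m1E <-]]].
  rewrite {}m1E in m'E; rewrite {}m'E in mm' eq2; rewrite -ux -vy in swA1 *.
  have [A [swA r1 r2 r3]] := lift_swap swA1.
  exists (mvar (swap A x y) + mvar (swap A y x) + m2)%MM; split.
  - apply: (mcong_trans idI mm'); rewrite addmA.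
    by apply: (mcongD idI); [apply: mcong_swap | apply: mcong_refl].
  - by rewrite !marginalD !marginalX r1 r2 addmC.
  - by rewrite -eq2 !marginalD !marginalX r3 addmA.
apply/PQ; rewrite -(@invariant_of_ideal_gen _ _ _ P _ a b ab).
  by apply/PQ; exists m; split=> //; apply: (mcong_refl idI).
move=> f /gmarkov_gens_swap[A1 [u [v [swA1 ->]]]].
do 2!eexists; split; first by [].
move=> c; apply/PQ/PQ; first exact: swQ.
(* Swapping twice is the identity, which gives the converse implication. *)
have swKK u' v' : swap A1 (swap A1 u' v') (swap A1 v' u') = u'.
  by apply/ffunP=> w; rewrite !ffunE; case: (w \in A1).
move/(@swQ A1); rewrite !swKK; apply=> w w' Aw nAw' ww'; rewrite !ffunE (negPf nAw').
exact: swA1 ww'.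
Qed.

(** For a variable [x] of [m'], equality of marginals provides variables [y] and [z] of [m] agreeing
    with [x] on [V1] and on [V2]. If they differ, swapping them outside [V1] creates [x], which is
    then cancelled. *)
Lemma mcong_of_marginals m m' :
    marginal V1 m = marginal V1 m' -> marginal V2 m = marginal V2 m' ->
  mcong Igl m m'.
Proof.
have idI := gmarkov_is_ideal k d.
case: (Gred) => _ _ _ /setP covV edgeV.
elim/mnm_consind: m' m => [|i m' IHm'] m.
  rewrite /marginal => m0 _; have -> : m = 0%MM; last exact: mcong_refl.
  apply: (@mnm_push_eq0 _ _ (restr_rank V1)); rewrite m0.
  by apply/mnmP=> j; rewrite mnmE mnm0E big1 // => i _; rewrite mnm0E.
rewrite -(enum_valK i) -/(mvar (enum_val i)); move: (enum_val i) => x {i}.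
rewrite !marginalD !marginalX => m1 m2.
have [y [n [xy mE n1]]] := marginal_cover m1.
have [z [n' [xz mE' n2]]] := marginal_cover m2.
have xE v : x v = if v \in V1 then y v else z v.
  have [V1v|nV1v] := boolP (v \in V1).
    by have /ffunP/(_ (Sub v V1v)) := xy; rewrite !ffunE.
  have V2v : v \in V2 by have := covV v; rewrite !inE (negPf nV1v).
  by have /ffunP/(_ (Sub v V2v)) := xz; rewrite !ffunE.
have yz_V2 v : v \in V2 -> v \in V1 -> y v = z v.
  move=> V2v V1v; have /ffunP/(_ (Sub v V2v)) := xz; rewrite !ffunE => ->.
  by rewrite xE V1v.
have [eq_yz|neq_yz] := eqVneq y z.
  have eq_xy : x = y by apply/ffunP=> v; rewrite xE -eq_yz if_same.
  rewrite mE eq_xy; apply: (mcongD idI); first exact: mcong_refl.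
  apply: IHm' => //; apply: (@addmI _ (mvar (restr V2 x))).
  by rewrite -m2 mE marginalD marginalX eq_xy.
have [q nE] : exists q, n = (mvar z + q)%MM.
  exists (n - mvar z)%MM; rewrite addmC submK //; apply/mnm_lepP=> j; rewrite mnm1E.
  case: eqP => // <-; have := congr1 (fun u : 'X_{1..#|state d|} => u (enum_rank z)) mE'.
  rewrite mE !mnmDE !mnm1E eqxx (inj_eq enum_rank_inj) (negPf neq_yz) add0n => ->.
  by rewrite addSn.
(* An edge leaving the complement of [V1] ends in [V1 :&: V2], where [y] and [z] both agree with
   [x]. *)
have swA : swappable (~: V1) y z.
  move=> a b; rewrite !inE negbK => nV1a V1b ab; apply: yz_V2 => //.
  by case: (edgeV a b ab) => -[] //; rewrite (negPf nV1a).
pose w := swap (~: V1) z y.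
have xs : x = swap (~: V1) y z.
  by apply/ffunP=> v; rewrite !ffunE inE xE; case: (v \in V1).
have wz : restr V1 w = restr V1 z.
  by apply/ffunP=> -[v V1v]; rewrite !ffunE inE /= V1v.
have wy : restr V2 w = restr V2 y.
  apply/ffunP=> -[v V2v]; rewrite !ffunE inE /=; case: (boolP (v \in V1)) => //= V1v.
  by rewrite yz_V2.
(* The partner [w] restricts to [z] on [V1] and to [y] on [V2], so removing [x] leaves the marginals
   that the induction needs. *)
apply: (mcong_trans idI (m2 := (mvar x + (mvar w + q))%MM)).
  rewrite mE nE !addmA; apply: (mcongD idI); last exact: mcong_refl.
  by rewrite xs; apply: mcong_swap.
apply: (mcongD idI); first exact: mcong_refl.
apply: IHm'.
  by rewrite -n1 nE !marginalD !marginalX wz.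
apply: (@addmI _ (mvar (restr V2 x))).
by rewrite -m2 mE nE !marginalD !marginalX wy -xz Monoid.mulmCA.
Qed.

End Lift.
End Marginals.

(** * Passage from the two induced subgraphs to the whole graph *)

Lemma reducible_sym (G : sgraph) (V1 V2 : {set G}) : reducible V1 V2 -> reducible V2 V1.
Proof.
case=> p1 p2 clq cov edge; split=> //; rewrite 1?setIC 1?setUC // => u v.
by case/edge; [right | left].
Qed.

Theorem lemma4p3 (k : closedFieldType) (G : sgraph) (V1 V2 : {set G})
    (d : G -> nat)
    (Gred : reducible V1 V2)
    (d_ge2 : forall v : G, (2 <= d v)%N)
    (rad1 : radical (@gmarkov_ideal k (induced V1) (fun v => d (val v))))
    (rad2 : radical (@gmarkov_ideal k (induced V2) (fun v => d (val v)))) :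
  radical (@gmarkov_ideal k G d).
Proof.
move=> f N N_gt0 IfN; pose I : {mpoly k[#|state d|]} -> Prop := @gmarkov_ideal k G d.
have idI : is_ideal I by apply: gmarkov_is_ideal.
have marginal_cong W m m' :
    radical (@gmarkov_ideal k (induced W) (fun v => d (val v))) ->
    (forall alpha, binomial_point I alpha -> mval alpha m = mval alpha m') ->
    mcong (@gmarkov_ideal k (induced W) (fun v => d (val v))) (marginal W m) (marginal W m').
  move=> radW eq_mm'; apply: binomial_nullstellensatz => // [|alpha alphaP].
    exact: gmarkov_is_ideal.
  by rewrite !mval_push; apply: eq_mm'; apply: binomial_point_restr.
apply: (@ideal_of_vanishing k _ (binomial_point I) _ _ I idI)
  => [c c' _|a b aP bP c c' cc'|m m' eq_mm'|alpha alphaP].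
- by rewrite !mval1.
- by rewrite !mvalM (aP c c') // (bP c c').
(* First the [V1]-marginal is changed to that of [m'] with the [V2]-marginal kept, then the roles
   are exchanged; the resulting [m2] has both marginals of [m']. *)
- have [m1 [mm1 m1V1 m1V2]] := lift_mcong Gred (marginal_cong V1 m m' rad1 eq_mm') (erefl _).
  have := marginal_cong V2 m m' rad2 eq_mm'.
  rewrite -m1V2 => m1m'.
  have [m2 [m1m2 m2V2 m2V1]] := lift_mcong (reducible_sym Gred) m1m' (erefl _).
  apply: (mcong_trans idI mm1); apply: (mcong_trans idI m1m2).
  by apply: (mcong_of_marginals k Gred) => //; rewrite m2V1.
(* At every point [f ^+ N] vanishes, hence so does [f]. *)
- have /eqP := meval_gmarkov ((binomial_pointP alpha).1 alphaP) IfN.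
  by rewrite rmorphXn expf_eq0 N_gt0 => /eqP.
Qed.
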